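(* Let $R$ be an algebraic curvature tensor on $\mathbb{R}^n$. The following are equivalent: (1) $R\in\hat C$, i.e. the algebraic curvature tensor $\hat R$ on $\mathbb{R}^n\times\mathbb{R}^2$ has nonnegative isotropic curvature; (2) $R$ has nonnegative complex sectional curvature.
   Context: Algebraic curvature tensors are $4$-linear forms with the symmetries of the Riemann curvature tensor (including the first Bianchi identity), with the sign convention that $R(X,Y,X,Y)$ is the sectional curvature for orthonormal $X,Y$. Euclidean inner products $\langle\cdot,\cdot\rangle$ are extended to symmetric $\mathbb{C}$-bilinear forms on the complexification, and curvature tensors are extended $\mathbb{C}$-linearly. $R$ has nonnegative complex sectional curvature if $R(Z,W,\overline Z,\overline W)\ge0$ for all linearly independent $Z,W\in\mathbb{C}^n$. An algebraic curvature tensor $S$ on $\mathbb{R}^m$ has nonnegative isotropic curvature if $S(Z,W,\overline Z,\overline W)\ge0$ whenever $Z,W\in\mathbb{C}^m$ are linearly independent and span an isotropic $2$-plane, i.e. $\langle Z,Z\rangle=\langle W,W\rangle=\langle Z,W\rangle=0$. Let $\pi:\mathbb{R}^n\times\mathbb{R}^2\to\mathbb{R}^n$ be the projection and define $\hat R(x,y,z,w)=R(\pi(x),\pi(y),\pi(z),\pi(w))$ for $x,y,z,w\in\mathbb{R}^n\times\mathbb{R}^2$. Then $\hat C=\{R : \hat R\text{ has nonnegative isotropic curvature}\}$. *)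

(* Defs.v *)
From mathcomp Require Import all_boot all_order all_algebra.
From mathcomp Require Import complex ring classical_sets reals.

Set Implicit Arguments.
Unset Strict Implicit.
Unset Printing Implicit Defensive.

Import Order.TTheory GRing.Theory Num.Theory.
Local Open Scope ring_scope.
Local Open Scope complex_scope.
Local Open Scope classical_set_scope.

Section CurvatureTensors.
Variable R : realType.

Record is_curvature_tensor (n : nat)
    (T : 'rV[R]_n -> 'rV[R]_n -> 'rV[R]_n -> 'rV[R]_n -> R) : Prop := {
  curv_linear1 : forall y z w, scalar (fun x => T x y z w);
  curv_linear2 : forall x z w, scalar (fun y => T x y z w);
  curv_linear3 : forall x y w, scalar (fun z => T x y z w);
  curv_linear4 : forall x y z, scalar (fun w => T x y z w);
  curv_anti12 : forall x y z w, T y x z w = - T x y z w;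
  curv_anti34 : forall x y z w, T x y w z = - T x y z w;
  curv_pair : forall x y z w, T z w x y = T x y z w;
  curv_bianchi : forall x y z w, T x y z w + T y z x w + T z x y w = 0 }.

Record curvature_tensor (n : nat) := CurvatureTensor {
  curv_form :> 'rV[R]_n -> 'rV[R]_n -> 'rV[R]_n -> 'rV[R]_n -> R;
  curv_formP : is_curvature_tensor curv_form }.

(* When f is R-linear, this is its unique C-linear extension to C^n
   (see [complexify_linear] and [complexify_real]). *)
Definition complexify (n : nat) (f : 'rV[R]_n -> R[i]) (Z : 'rV[R[i]]_n) :
    R[i] :=
  f (map_mx (@complex.Re R) Z) + 'i * f (map_mx (@complex.Im R) Z).

Lemma complexify_linear (n : nat) (f : 'rV[R]_n -> R[i]) :
  (forall (a : R) x y, f (a *: x + y) = a%:C * f x + f y) ->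
  scalar (complexify f).
Proof.
move=> fL [a b] Z W; rewrite /complexify.
have -> : map_mx (@complex.Re R) ((a +i* b) *: Z + W) =
    a *: map_mx (@complex.Re R) Z +
    ((- b) *: map_mx (@complex.Im R) Z + map_mx (@complex.Re R) W).
  apply/rowP=> j; rewrite !mxE.
  by case: (Z 0 j) (W 0 j) => [x y] [u v] /=; rewrite mulNr addrA.
have -> : map_mx (@complex.Im R) ((a +i* b) *: Z + W) =
    a *: map_mx (@complex.Im R) Z +
    (b *: map_mx (@complex.Re R) Z + map_mx (@complex.Im R) W).
  apply/rowP=> j; rewrite !mxE.
  by case: (Z 0 j) (W 0 j) => [x y] [u v] /=; rewrite addrA.
rewrite !fL.
case: (f _) => [p q]; case: (f _) => [r s]; case: (f _) => [t u].
case: (f _) => [v w]; apply/eqP; rewrite eq_complex /=.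
by apply/andP; split; apply/eqP; ring.
Qed.

Lemma complexify_real (n : nat) (f : 'rV[R]_n -> R[i]) (x : 'rV[R]_n) :
  f 0 = 0 -> complexify f (map_mx (real_complex R) x) = f x.
Proof.
move=> f0; rewrite /complexify.
have -> : map_mx (@complex.Im R) (map_mx (real_complex R) x) = 0.
  by apply/rowP=> j; rewrite !mxE.
rewrite f0 mulr0 addr0; congr (f _).
by apply/rowP=> j; rewrite !mxE.
Qed.

Definition dot (n : nat) (x y : 'rV[R]_n) : R := \sum_j x 0 j * y 0 j.

Definition dotC (n : nat) (Z W : 'rV[R[i]]_n) : R[i] :=
  complexify (fun x => complexify (fun y => (dot x y)%:C) W) Z.

Definition curvC (n : nat) (T : curvature_tensor n)
    (X Y Z W : 'rV[R[i]]_n) : R[i] :=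
  complexify (fun x => complexify (fun y => complexify (fun z =>
    complexify (fun w => (T x y z w)%:C) W) Z) Y) X.

Definition conj_vec (n : nat) (Z : 'rV[R[i]]_n) : 'rV[R[i]]_n :=
  map_mx (@conjc R) Z.

Definition lin_indep (n : nat) (Z W : 'rV[R[i]]_n) : bool :=
  row_free (col_mx Z W).

(* In R[i], [0 <= c] means that c is real and nonnegative.  Since the sectional
   curvature is T x y x y on orthonormal x, y, the bars are on slots 3, 4. *)
Definition nonneg_complex_sectional_curvature (n : nat)
    (T : curvature_tensor n) : Prop :=
  forall Z W : 'rV[R[i]]_n, lin_indep Z W ->
    0 <= curvC T Z W (conj_vec Z) (conj_vec W).

Definition nonneg_isotropic_curvature (m : nat)
    (S : curvature_tensor m) : Prop :=
  forall Z W : 'rV[R[i]]_m, lin_indep Z W ->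
    dotC Z Z = 0 -> dotC W W = 0 -> dotC Z W = 0 ->
    0 <= curvC S Z W (conj_vec Z) (conj_vec W).

(* R^n x R^2 is 'rV_(n + 2), and the projection to R^n is [lsubmx]. *)
Definition hat_form (n : nat) (T : curvature_tensor n)
    (x y z w : 'rV[R]_(n + 2)) : R :=
  T (lsubmx x) (lsubmx y) (lsubmx z) (lsubmx w).

Lemma hat_formP (n : nat) (T : curvature_tensor n) :
  is_curvature_tensor (hat_form T).
Proof.
case: T => T [l1 l2 l3 l4 a12 a34 p b]; rewrite /hat_form /=.
by split=> // *; move=> a u v; rewrite linearP;
  [apply: l1 | apply: l2 | apply: l3 | apply: l4].
Qed.

Definition hat (n : nat) (T : curvature_tensor n) : curvature_tensor (n + 2) :=
  CurvatureTensor (hat_formP T).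

Definition hat_cone (n : nat) : set (curvature_tensor n) :=
  [set T | nonneg_isotropic_curvature (hat T)].

End CurvatureTensors.

(* Main.v *)
(** A vector of C^n lifts to C^n x C^2 with any prescribed C^2-component, and
    the hatted tensor does not see that component.  Two vectors of C^2 with
    arbitrary prescribed bilinear products exist, since every symmetric complex
    2 x 2 matrix is of the form [M *m M^T]; hence any Z, W lift to an isotropic
    pair.  Conversely, an isotropic pair projects either to an independent
    pair or to a dependent one, on which the curvature vanishes. *)

Require Import Defs.
From mathcomp Require Import all_boot all_order all_algebra.
From mathcomp Require Import complex classical_sets reals.
From mathcomp Require Import ring.

Set Implicit Arguments.
Unset Strict Implicit.
Unset Printing Implicit Defensive.

Import Order.TTheory GRing.Theory Num.Theory.
Local Open Scope ring_scope.
Local Open Scope complex_scope.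

(** A nonzero diagonal entry [p] or [r] allows a triangular factorisation by square roots; if both
    vanish, two isotropic vectors with product [q] are needed. *)
Lemma symmetric_gram2 (C : numClosedFieldType) (p q r : C) :
  exists u1 u2 v1 v2 : C,
    [/\ u1 * u1 + u2 * u2 = p, v1 * v1 + v2 * v2 = r &
        u1 * v1 + u2 * v2 = q].
Proof.
have nondeg (a b c : C) : a != 0 -> exists u v1 v2 : C,
    [/\ u * u = a, v1 * v1 + v2 * v2 = c & u * v1 = b].
  (* As in Cholesky: once [u] is chosen, [u * v1 = b] forces [v1], and [v2] makes up the rest of
     [c]. *)
  move=> a0; exists (sqrtC a), (b / sqrtC a), (sqrtC (c - b ^+ 2 / a)).
  rewrite -!expr2 expr_div_n !sqrtCK; split=> //; first by ring.
  by rewrite mulrC divfK ?sqrtC_eq0.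
have [p0|/nondeg-/(_ q r)] := eqVneq p 0; last first.
  case=> u [v1 [v2 [uu vv uv]]]; exists u, 0, v1, v2.
  by rewrite !mul0r !addr0.
have [r0|/nondeg-/(_ q p)] := eqVneq r 0; last first.
  case=> v [u1 [u2 [vv uu vu]]]; exists u1, u2, v, 0.
  by rewrite !mulr0 !addr0 [u1 * v]mulrC.
have i2 := sqrCi C.
(* The vectors (1, i) and (1, -i) are isotropic with product 2, hence the factor [q / 2]. *)
exists 1, 'i%R, (q / 2), (- ('i%R * (q / 2))); rewrite p0 r0.
split; first by rewrite -(expr2 'i%R) i2 mulr1 subrr.
  by rewrite mulrNN [X in _ + X]mulrACA -(expr2 'i%R) i2 mulN1r subrr.
by rewrite mul1r mulrN [X in _ - X]mulrA -(expr2 'i%R) i2 mulN1r opprK -splitr.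
Qed.

Section ComplexifiedForms.
Variables (R : realType) (n : nat).
Implicit Types (T : curvature_tensor R n) (X Y Z W : 'rV[R[i]]_n).

Lemma dotCE Z W : dotC Z W = \sum_j Z 0 j * W 0 j.
Proof.
rewrite /dotC /complexify /dot !rmorph_sum /= !mulr_sumr -!big_split /=.
rewrite mulr_sumr -big_split; apply: eq_bigr => j _ /=; rewrite !mxE.
case: (Z 0 j) (W 0 j) => [a b] [c d]; apply/eqP; rewrite eq_complex /=.
by apply/andP; split; apply/eqP; ring.
Qed.

Lemma curvC_anti12 T X Y Z W : curvC T Y X Z W = - curvC T X Y Z W.
Proof.
case: T => T [l1 l2 l3 l4 a12 a34 p b]; rewrite /curvC /complexify /=.
(* Fixing the real and imaginary parts of [X] as second argument keeps the repeated rewriting by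
   [a12] from swapping back. *)
set x := map_mx _ X; set x' := map_mx _ X.
set y := map_mx _ Y; set y' := map_mx _ Y.
by rewrite !(a12 x) !(a12 x') !rmorphN /=; ring.
Qed.

Lemma curvC_alt12 T X Z W : curvC T X X Z W = 0.
Proof. by apply/eqP; rewrite -eqNr -curvC_anti12. Qed.

Lemma curvC_linear1 T Y Z W : scalar (fun X => curvC T X Y Z W).
Proof.
move=> a X X'; apply: complexify_linear => {X X'} b x x'.
case: T => T [l1 l2 l3 l4 a12 a34 p bi]; rewrite /complexify /=.
by rewrite !l1 !rmorphD !rmorphM /=; ring.
Qed.

Lemma lin_indepPn Z W : ~~ lin_indep Z W ->
  exists2 ab : R[i] * R[i], ab != 0 & ab.1 *: Z + ab.2 *: W = 0.
Proof.
rewrite /lin_indep -kermx_eq0 => /rowV0Pn[v /sub_kermxP].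
rewrite -[v]hsubmxK mul_row_col.
rewrite [lsubmx v]mx11_scalar [rsubmx v]mx11_scalar !mul_scalar_mx => eq0 v0.
exists (lsubmx v 0 0, rsubmx v 0 0) => //.
apply: contraNneq v0 => -[/= -> ->].
by rewrite !raddf0 row_mx0.
Qed.

(** Replacing [a *: X] by [- b *: Y] in the first slot leaves a multiple of [curvC T Y Y Z W], which
    vanishes. *)
Lemma curvC_relation T (a b : R[i]) X Y Z W :
  a *: X + b *: Y = 0 -> a * curvC T X Y Z W = 0.
Proof.
move=> /eqP; rewrite addr_eq0 -scaleNr => /eqP aX.
(* The term [curvC T 0 Y Z W] arises on both sides and cancels. *)
have := curvC_linear1 T Y Z W a X 0.
rewrite /= aX curvC_linear1 curvC_alt12 mulr0.
by move/addIr.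
Qed.

Lemma curvC_dependent T X Y Z W : ~~ lin_indep X Y -> curvC T X Y Z W = 0.
Proof.
case/lin_indepPn=> -[a b] ab0 /= rel; apply/eqP.
have /eqP := curvC_relation T Z W rel.
(* With the roles of [X] and [Y] exchanged, [b] also annihilates the curvature, and [a], [b] are not
   both zero. *)
rewrite addrC in rel; have /eqP := curvC_relation T Z W rel.
rewrite curvC_anti12 mulrN oppr_eq0 !mulf_eq0.
by move: ab0; rewrite xpair_eqE; do 2 case: eqP.
Qed.

End ComplexifiedForms.

Lemma curvC_hat (R : realType) (n : nat) (T : curvature_tensor R n)
    (X Y Z W : 'rV[R[i]]_(n + 2)) :
  curvC (hat T) X Y Z W =
  curvC T (lsubmx X) (lsubmx Y) (lsubmx Z) (lsubmx W).
Proof. by rewrite /curvC /complexify /= /hat_form !map_lsubmx. Qed.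

(** A right inverse of [col_mx Z W], padded with zero rows, is a right inverse of the extended
    matrix. *)
Lemma lin_indep_row_mx (R : realType) (m n : nat) (Z W : 'rV[R[i]]_m)
    (u v : 'rV[R[i]]_n) :
  lin_indep Z W -> lin_indep (row_mx Z u) (row_mx W v).
Proof.
case/row_freeP=> B ZWB; apply/row_freeP; exists (col_mx B 0).
by rewrite -block_mxEv block_mxEh mul_row_col ZWB mulmx0 addr0.
Qed.

Lemma dotC_row_mx (R : realType) (m n : nat) (Z W : 'rV[R[i]]_m)
    (u v : 'rV[R[i]]_n) :
  dotC (row_mx Z u) (row_mx W v) = dotC Z W + dotC u v.
Proof.
rewrite !dotCE big_split_ord /=.
by congr (_ + _); apply: eq_bigr => j _; rewrite ?row_mxEl ?row_mxEr.
Qed.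

Lemma isotropic_lift (R : realType) (n : nat) (Z W : 'rV[R[i]]_n) :
  exists u v : 'rV[R[i]]_2,
    [/\ dotC (row_mx Z u) (row_mx Z u) = 0,
        dotC (row_mx W v) (row_mx W v) = 0 &
        dotC (row_mx Z u) (row_mx W v) = 0].
Proof.
(* The Gram matrix of the added components must be the negative of that of [Z], [W]. *)
have [u1 [u2 [v1 [v2 [uu vv uv]]]]] :=
  symmetric_gram2 (- dotC Z Z) (- dotC Z W) (- dotC W W).
pose vec2 (a b : R[i]) : 'rV_2 := \row_j (if j == 0 then a else b).
have dot2 a b c d : dotC (vec2 a b) (vec2 c d) = a * c + b * d.
  by rewrite dotCE !big_ord_recl big_ord0 addr0 !mxE.
exists (vec2 u1 u2), (vec2 v1 v2).
by rewrite !dotC_row_mx !dot2 uu vv uv !subrr.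
Qed.

Theorem proposition5p1 (R : realType) (n : nat) (T : curvature_tensor R n) :
  hat_cone T <-> nonneg_complex_sectional_curvature T.
Proof.
split=> [isoT Z W indep | secT Z W _ _ _ _].
  have [u [v [uu vv uv]]] := isotropic_lift Z W.
  have := isoT _ _ (lin_indep_row_mx u v indep) uu vv uv.
  by rewrite curvC_hat /conj_vec !map_row_mx !row_mxKl.
rewrite curvC_hat /conj_vec -!map_lsubmx.
(* Independence of [Z], [W] may be lost under projection. *)
have [|dep] := boolP (lin_indep (lsubmx Z) (lsubmx W)); first exact: secT.
by rewrite curvC_dependent.
Qed.
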